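(* Fix $n\in\mathbb{N}$, $p\in[2,\infty)$ and $K\in[1,\infty)$. Let $X$ be a normed space with $\dim X=n<\infty$, and let $(Y,\|\cdot\|)$ be a Banach space whose norm satisfies $$\forall\, x,y\in Y,\qquad 2\|x\|^p+\frac{2}{K^p}\|y\|^p\leqslant \|x+y\|^p+\|x-y\|^p .$$ Then for all $\varepsilon\in\left(0,\frac12\right)$ we have $$r^{X\to Y}(\varepsilon)\geqslant \begin{cases} \varepsilon^{(16K/\varepsilon)^p} & \text{if } n=1,\\[4pt] \varepsilon^{K^p n^{20(n+p)}/\varepsilon^{2p+2n-2}} & \text{if } n\geqslant 2,\end{cases}$$ where $r^{X\to Y}(\cdot)$ is the modulus of affine approximability.
   Context: Modulus of affine approximability: let $X,Y$ be Banach spaces with closed unit balls $B_X,B_Y$. For $\varepsilon\in(0,1)$, $r^{X\to Y}(\varepsilon)$ is the supremum over those $r\in(0,1]$ such that for every Lipschitz function $f:B_X\to Y$ there exist $y\in X$ and $\rho\in[r,\infty)$ with $y+\rho B_X\subseteq B_X$, and there exists an affine mapping $A:X\to Y$, such that $$\sup_{z\in y+\rho B_X}\frac{\|f(z)-A(z)\|}{\rho}\leqslant \varepsilon\|f\|_{\mathrm{Lip}},$$ where $\|f\|_{\mathrm{Lip}}$ is the Lipschitz constant of $f$. If no such $r\in(0,1]$ exists then $r^{X\to Y}(\varepsilon)=0$. *)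

(* Defs.v *)
From HB Require Import structures.
From mathcomp Require Import all_boot all_order all_algebra.
From mathcomp Require Import all_classical all_reals all_analysis.

Set Implicit Arguments.
Unset Strict Implicit.
Unset Printing Implicit Defensive.

Import Order.TTheory GRing.Theory Num.Theory numFieldNormedType.Exports.
Local Open Scope classical_set_scope.
Local Open Scope ring_scope.

Section AffineApproximability.
Context {R : realType}.

(* The pairs x = y are harmless: they contribute 0 / 0 = 0, which also makes
   the constant 0, and not -oo, when A is a singleton. *)
Definition lip_const {X Y : normedModType R} (A : set X) (f : X -> Y) : \bar R :=
  ereal_sup [set (`|f xy.1 - f xy.2| / `|xy.1 - xy.2|)%:E | xy in A `*` A].

(* In infinite dimension an affine mapping need not be continuous. *)
Definition affine_map {X Y : lmodType R} (A : X -> Y) : Prop :=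
  exists (T : {linear X -> Y}) (b : Y), forall x, A x = T x + b.

Definition unit_cball (X : normedModType R) : set X := closed_ball_ Num.norm 0 1.

(* A function B_X -> Y is represented by a function X -> Y of which only the
   values on B_X are used. *)
Definition affinely_approximable_at (X Y : normedModType R) (eps r : R) : Prop :=
  forall f : X -> Y, [lipschitz f x | x in @unit_cball X] ->
  exists (y : X) (rho : R) (A : X -> Y),
    [/\ r <= rho,
        closed_ball_ Num.norm y rho `<=` @unit_cball X,
        affine_map A &
        (ereal_sup [set (`|f z - A z| / rho)%:E | z in closed_ball_ Num.norm y rho]
          <= eps%:E * lip_const (@unit_cball X) f)%E].

(* The real-valued sup is 0 on the empty set, as the definition of the modulus
   requires; otherwise the set is bounded by 1. *)
Definition affine_modulus (X Y : normedModType R) (eps : R) : R :=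
  sup [set r : R | 0 < r <= 1 /\ affinely_approximable_at X Y eps r].

End AffineApproximability.

(* Main.v *)
Require Import Defs.
From HB Require Import structures.
From mathcomp Require Import all_boot all_order all_algebra.
From mathcomp Require Import all_classical all_reals all_analysis.
From mathcomp Require Import perm ring lra.

Import Order.TTheory GRing.Theory Num.Theory numFieldNormedType.Exports.
Local Open Scope classical_set_scope.
Local Open Scope ring_scope.

(** The idea is to look for a cube on which the discrete gradient of the map
    barely fluctuates when the cube is subdivided, and to find it by an energy
    argument which rests on the p-convexity of the norm of Y.

    In suitable coordinates a Lipschitz map on the ball of X becomes a map G on
    a grid of N^T points in each of the n directions.  For a cube of side N^k,
    average the unit increments of G in direction i over the points of the
    cube.  The average for a cube of side N^(k+1) is the mean of the averages
    for its N^n children: these slopes form a martingale.  The two-point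
    convexity inequality extends to arbitrary finite means
    (uniformly_convex_mean), so that passing from a cube to its children raises
    the mean p-th power of the slopes by at least a multiple of their mean
    p-th power fluctuation.  As the slopes are bounded by the Lipschitz
    constant, some cube of one of the T generations gains at most a fraction
    1/T of the maximal energy (exists_flat_cube), hence has nearly constant
    slopes.

    On such a cube G is nearly affine.  Along a column of children in direction
    i the slopes telescope to a difference of averages of G over faces of
    children, and such an average is close to a value of G because the children
    are N times smaller than the cube (column_increment_near).  Joining the
    corner of the cube to any point by moving one coordinate at a time gives
    the affine approximation (exists_almost_affine_cube).  Only sums of
    fluctuations along single columns enter here; a column holds a fraction
    N^(1-n) of the children, and this is the only loss which grows
    exponentially with n.

    The coordinates come from a basis of X whose determinant is almost maximal
    among vectors of the unit ball (exists_near_auerbach_basis): coordinate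
    functionals then have norm close to 1, and cubes and balls compare up to a
    factor about n.  For an error eps one takes N of order n^2 / eps and T of
    order n N^(n-1) (n K / eps)^p, and the ball obtained has radius at least of
    order N^(1-T) / n, which exceeds the announced power of eps. *)

Set Implicit Arguments.
Unset Strict Implicit.

(** * Powers of means and uniform convexity *)

(** Bernoulli's inequality, from [expR y >= 1 + y]: write [s `^ p] as
    [s * expR ((p - 1) * ln s)] and bound [ln s] below by [1 - s^-1]. *)
Lemma powR_ge_tangent (R : realType) (p s : R) :
  1 <= p -> 0 <= s -> 1 + p * (s - 1) <= s `^ p.
Proof.
move=> p1; rewrite le_eqVlt => /predU1P[<-|s0].
  by rewrite powR0; [lra|apply/eqP; lra].
rewrite -(@mulr_powRB1 _ s p) ?(ltW s0)//; last lra.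
have ln_ge : 1 - s^-1 <= ln s.
  have := expR_ge1Dx (- ln s); rewrite expRN lnK//; lra.
rewrite [_ `^ (p - 1)]/powR gt_eqF//.
have exp_ge : 1 + (p - 1) * (1 - s^-1) <= expR ((p - 1) * ln s).
  apply: le_trans (expR_ge1Dx _); rewrite lerD2l ler_wpM2l//; lra.
apply: le_trans (ler_wpM2l (ltW s0) exp_ge).
have -> : s * (1 + (p - 1) * (1 - s^-1)) = s + (p - 1) * (s - s * s^-1) by ring.
by rewrite divff ?gt_eqF//; lra.
Qed.

(** Jensen's inequality: sum the tangent-line bound at the mean. *)
Lemma powR_mean_le (R : realType) (T : finType) (p : R) (t : T -> R) :
  1 <= p -> (forall x, 0 <= t x) ->
  #|T|%:R * (#|T|%:R^-1 * \sum_x t x) `^ p <= \sum_x t x `^ p.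
Proof.
move=> p1 t0; set m := _^-1 * _.
have m0 : 0 <= m by rewrite mulr_ge0 ?invr_ge0// sumr_ge0.
move: m0; rewrite le_eqVlt => /predU1P[m0|m0].
  rewrite -m0 powR0 ?mulr0; last by apply/eqP; lra.
  by rewrite sumr_ge0// => x _; rewrite powR_ge0.
have cardT0 : #|T|%:R != 0 :> R.
  by apply: contraTneq m0 => c0; rewrite /m c0 invr0 mul0r ltxx.
have tangent x : m `^ p * (1 + p * (t x / m - 1)) <= t x `^ p.
  have tm0 : 0 <= t x / m by rewrite divr_ge0// ltW.
  rewrite -{2}[t x](divfK (lt0r_neq0 m0)) (@powRM _ (t x / m) m) ?(ltW m0)//.
  by rewrite mulrC ler_wpM2r ?powR_ge0// powR_ge_tangent.
apply: le_trans (ler_sum _ (fun x _ => tangent x)).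
rewrite -mulr_sumr big_split/= -mulr_sumr sumrB -mulr_suml.
rewrite !sumr_const -(mulVKf cardT0 (\sum_i t i)) -/m.
by rewrite mulfK ?gt_eqF// subrr mulr0 addr0 mulrC.
Qed.

Section Mean.
Variables (R : realType) (T : finType).

Definition mean (V : lmodType R) (v : T -> V) : V :=
  #|T|%:R^-1 *: \sum_x v x.

Lemma meanD (V : lmodType R) (v w : T -> V) :
  mean (fun x => v x + w x) = mean v + mean w.
Proof. by rewrite /mean big_split scalerDr. Qed.

Lemma meanN (V : lmodType R) (v : T -> V) : mean (fun x => - v x) = - mean v.
Proof. by rewrite /mean sumrN scalerN. Qed.

Lemma meanB (V : lmodType R) (v w : T -> V) :
  mean (fun x => v x - w x) = mean v - mean w.
Proof. by rewrite meanD meanN. Qed.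

Lemma meanZ (V : lmodType R) (a : R) (v : T -> V) :
  mean (fun x => a *: v x) = a *: mean v.
Proof. by rewrite /mean -scaler_sumr !scalerA mulrC. Qed.

Lemma eq_mean (V : lmodType R) (v w : T -> V) : v =1 w -> mean v = mean w.
Proof. by move=> e; rewrite /mean (eq_bigr w). Qed.

Hypothesis T_gt0 : (0 < #|T|)%N.

Lemma mean_const (V : lmodType R) (a : V) : mean (fun=> a) = a.
Proof.
rewrite /mean sumr_const -[a *+ _]scaler_nat scalerA mulVf ?scale1r//.
by rewrite pnatr_eq0 -lt0n.
Qed.

Lemma norm_mean_le (V : normedModType R) (v : T -> V) :
  `|mean v| <= #|T|%:R^-1 * \sum_x `|v x|.
Proof.
by rewrite normrZ ger0_norm ?invr_ge0// ler_wpM2l ?invr_ge0// ler_norm_sum.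
Qed.

Lemma norm_mean_bound (V : normedModType R) (v : T -> V) (b : R) :
  (forall x, `|v x| <= b) -> `|mean v| <= b.
Proof.
move=> vb; apply: le_trans (norm_mean_le v) _.
rewrite ler_pdivrMl ?ltr0n// mulrC mulr_natr.
by apply: le_trans (ler_sum _ (fun x _ => vb x)) _; rewrite sumr_const.
Qed.

Lemma powR_norm_mean_le (V : normedModType R) (p : R) (v : T -> V) :
  1 <= p -> #|T|%:R * `|mean v| `^ p <= \sum_x `|v x| `^ p.
Proof.
move=> p1; apply: le_trans (powR_mean_le p1 (fun x => normr_ge0 (v x))).
rewrite ler_wpM2l// ge0_ler_powR//; first lra.
- by rewrite nnegrE.
- by rewrite nnegrE mulr_ge0 ?invr_ge0// sumr_ge0.
- exact: norm_mean_le.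
Qed.

(** The two-point inequality, applied to half the sum and half the difference
    of a value and the mean [m], bounds the p-th power of that value; the
    half-sums still have mean [m], so Jensen's inequality disposes of them. *)
Lemma uniformly_convex_mean (Y : normedModType R) (p K : R) (v : T -> Y) :
  1 <= p -> 0 < K ->
  (forall x y : Y,
      2 * `|x| `^ p + 2 / K `^ p * `|y| `^ p
        <= `|x + y| `^ p + `|x - y| `^ p) ->
  #|T|%:R * `|mean v| `^ p
    + 2 / (2 * K) `^ p * (\sum_x `|v x - mean v| `^ p)
  <= \sum_x `|v x| `^ p.
Proof.
move=> p1 K0 convY; set m := mean v.
pose half x := 2^-1 *: (v x + m).
have halfK (w : Y) : 2^-1 *: (w + w) = w.
  by rewrite -mulr2n -[w *+ 2]scaler_nat scalerA mulVf ?scale1r.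
have mean_half : mean half = m.
  by rewrite /half meanZ meanD mean_const halfK.
have := powR_norm_mean_le half p1; rewrite mean_half.
have two_point x : 2 * `|half x| `^ p
    + 2 / (2 * K) `^ p * `|v x - m| `^ p <= `|v x| `^ p + `|m| `^ p.
  have := convY (half x) (2^-1 *: (v x - m)).
  rewrite /half -scalerDr -scalerBr addrACA subrr addr0 opprB.
  rewrite [X in _ <= _ + `|_ *: X| `^ _](_ : _ = m + m); last first.
    by rewrite [v x + m]addrC addrACA subrr addr0.
  rewrite !halfK.
  apply: le_trans; rewrite lerD2l normrZ ger0_norm ?invr_ge0//.
  have inv2 : 2^-1 `^ p = (2 `^ p)^-1 :> R.
    by rewrite -powR_inv1// -powRrM mulN1r powRN.
  rewrite (powRM p (_ : 0 <= 2) (ltW K0))// powRM ?invr_ge0// inv2 invfM.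
  lra.
have := ler_sum (index_enum T) (fun x (_ : xpredT x) => two_point x).
rewrite !big_split/= -!mulr_sumr sumr_const -mulr_natl; lra.
Qed.

End Mean.

(** * Slopes over the cubes of a grid *)

Section GridSlopes.
Variables (R : realType) (n N : nat).
Implicit Types (a x y : 'I_n -> nat) (i j : 'I_n).

Definition update (T : Type) (u : 'I_n -> T) i (t : T) : 'I_n -> T :=
  fun j => if j == i then t else u j.

Definition translate a (m : nat) (c : 'I_n -> nat) : 'I_n -> nat :=
  fun j => (a j + m * c j)%N.

Definition step a i (m : nat) : 'I_n -> nat := update a i (a i + m)%N.

Definition cell := {ffun 'I_n -> 'I_N}.

Definition coords (c : cell) : 'I_n -> nat := fun j => c j.

Lemma card_cell : #|{: cell}| = (N ^ n)%N.
Proof. by rewrite card_ffun !card_ord. Qed.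

Lemma step0 a i : step a i 0 = a.
Proof.
by apply/funext => j; rewrite /step /update addn0; case: eqP => [->|].
Qed.

Lemma translate_update a m (c : 'I_n -> nat) i t :
  translate a m (update c i t) = step (translate a m (update c i 0)) i (m * t).
Proof.
apply/funext => j; rewrite /step /translate /update.
by have [->|//] := eqVneq j i; rewrite eqxx muln0 addn0.
Qed.

Lemma step_step a i m m' : step (step a i m) i m' = step a i (m + m').
Proof.
apply/funext => j; rewrite /step /update eqxx.
by case: eqP => // _; rewrite addnA.
Qed.

Lemma translate_step a i m m' (c : 'I_n -> nat) :
  translate (step a i m) m' (update c i 0) =
  step (translate a m' (update c i 0)) i m.
Proof.
apply/funext => j; rewrite /step /translate /update.
by case: (eqVneq j i) => // _; rewrite eqxx muln0 !addn0.
Qed.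

(** Exchanging [c i] with [t] is an involution of the pairs [(c, t)], and
    turns the left-hand side into a sum that ignores [t]. *)
Lemma sum_update (V : zmodType) i (phi : ('I_n -> nat) -> V) :
  \sum_(c : cell) \sum_(t < N) phi (update (coords c) i t) =
  (\sum_(c : cell) phi (coords c)) *+ N.
Proof.
rewrite -sumrMnl.
under [RHS]eq_bigr do rewrite -[in X in _ *+ X](card_ord N) -sumr_const.
rewrite !pair_bigA/=.
pose swap (q : cell * 'I_N) : cell * 'I_N :=
  ([ffun j => if j == i then q.2 else q.1 j], q.1 i).
have swapK : involutive swap.
  case=> c t; rewrite /swap /= ffunE eqxx; congr (_, _).
  by apply/ffunP => j; rewrite !ffunE; have [->|] := eqVneq j i.
rewrite [RHS](reindex_inj (inv_inj swapK)); apply: eq_bigr => -[c t] _ /=.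
congr phi; apply/funext => j; rewrite /update /coords ffunE.
by case: (j == i).
Qed.

Variables (Y : normedModType R) (G : ('I_n -> nat) -> Y).

(** The average, over the grid points of the cube of side [N ^ k] with corner
    [a], of the unit increments of [G] in direction [i].  Recursion on the
    subdivision makes the martingale property hold by definition. *)
Fixpoint slope i (k : nat) a : Y :=
  if k is k'.+1 then
    mean (fun c : cell => slope i k' (translate a (N ^ k') (coords c)))
  else G (step a i 1) - G a.

(** The average of [G] over the face of that cube where the coordinate [i] is
    the one of [a]. *)
Fixpoint face i (k : nat) a : Y :=
  if k is k'.+1 then
    mean (fun c : cell =>
            face i k' (translate a (N ^ k') (update (coords c) i 0)))
  else G a.

Lemma mean_update i (phi : ('I_n -> nat) -> Y) :
  N%:R *: mean (fun c : cell => phi (coords c)) =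
  mean (fun c : cell => \sum_(t < N) phi (update (coords c) i t)).
Proof.
rewrite -meanZ /mean sum_update -scaler_sumr.
by rewrite [X in _ *: X = _]scaler_nat.
Qed.

Lemma sum_steps (psi : ('I_n -> nat) -> Y) a i L m :
  \sum_(t < m) (psi (step (step a i (L * t)) i L) - psi (step a i (L * t))) =
  psi (step a i (L * m)) - psi a.
Proof.
under eq_bigr do rewrite step_step -mulnSr.
rewrite -(big_mkord xpredT (fun t => psi (step a i (L * t.+1)%N) -
  psi (step a i (L * t)%N))).
by rewrite telescope_sumr// muln0 step0.
Qed.

(** The discrete fundamental theorem of calculus: increments telescope along
    each line of the cube in direction [i]. *)
Lemma slope_face i k a :
  (N ^ k)%:R *: slope i k a = face i k (step a i (N ^ k)) - face i k a.
Proof.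
elim: k a => [|k IH] a; first by rewrite scale1r.
rewrite expnS natrM -scalerA /= -meanZ -meanB.
under eq_mean do rewrite IH.
rewrite (mean_update i (fun u => face i k (step (translate a (N ^ k) u) i _) -
  face i k (translate a (N ^ k) u))).
apply: eq_mean => c.
under eq_bigr do rewrite translate_update.
by rewrite sum_steps translate_step mulnC.
Qed.

Variable lam : R.
Hypothesis G_lip : forall x y,
  `|G x - G y| <= lam * \sum_i `|(x i)%:R - (y i)%:R|.
Hypotheses (lam_ge0 : 0 <= lam) (N_gt0 : (0 < N)%N).

Lemma cell_gt0 : (0 < #|{: cell}|)%N.
Proof. by rewrite card_cell expn_gt0 N_gt0. Qed.

Lemma norm_slope_le i k a : `|slope i k a| <= lam.
Proof.
elim: k a => [|k IH] a /=; last exact: (norm_mean_bound cell_gt0).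
apply: le_trans (G_lip _ _) _; rewrite (bigD1 i)//= big1 => [|j ji].
  by rewrite /step /update eqxx natrD addrAC subrr add0r addr0 normr1 mulr1.
by rewrite /step /update (negPf ji) subrr normr0.
Qed.

(** Inside a face only the [n.-1] other coordinates vary, each by at most
    [N ^ k - 1]. *)
Lemma face_near i k a :
  `|face i k a - G a| <= lam * (n.-1%:R * ((N ^ k)%:R - 1)).
Proof.
elim: k a => [|k IH] a /=; first by rewrite !subrr !mulr0 normr0.
rewrite -[G a](mean_const cell_gt0) -meanB.
apply: (norm_mean_bound cell_gt0) => c; set b := translate _ _ _.
rewrite -[_ - _](subrKA (G b)); apply: le_trans (ler_normD _ _) _.
have -> : (N ^ k.+1)%:R - 1 = (N ^ k)%:R - 1 + (N ^ k)%:R * (N%:R - 1) :> R.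
  by rewrite expnSr natrM; ring.
rewrite mulrDr [leRHS]mulrDr lerD ?IH//.
apply: le_trans (G_lip _ _) _; rewrite ler_wpM2l//.
rewrite (bigD1 i)//= /b /translate /update eqxx muln0 addn0 subrr normr0 add0r.
have -> : n.-1 = #|[pred j : 'I_n | j != i]|.
  by rewrite -[in LHS](card_ord n) -(cardC1 i).
rewrite mulr_natl -sumr_const; apply: ler_sum => j ji.
rewrite (negPf ji) natrD addrAC subrr add0r ger0_norm// natrM ler_wpM2l//.
by rewrite lerBrDr natr1 ler_nat ltn_ord.
Qed.

(** Along a column of [m] cubes the identities [slope_face] telescope; the only
    loss is in replacing [G] by its face averages at the two ends. *)
Lemma column_increment_near i k a m (S : Y) :
  `|G (step a i (N ^ k * m)) - G a - (N ^ k * m)%:R *: S| <=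
  (N ^ k)%:R * (2 * lam * n.-1%:R
                + \sum_(t < m) `|slope i k (step a i (N ^ k * t)) - S|).
Proof.
set L := (N ^ k)%N; set b := step a i _.
have column : \sum_(t < m) L%:R *: (slope i k (step a i (L * t)) - S) =
    face i k b - face i k a - (L * m)%:R *: S.
  under eq_bigr do rewrite scalerBr slope_face.
  rewrite sumrB (sum_steps (face i k)) sumr_const card_ord.
  by rewrite -[_ *+ m]scaler_nat scalerA -natrM (mulnC m).
have -> : G b - G a - (L * m)%:R *: S =
    (face i k a - G a) - (face i k b - G b)
      + \sum_(t < m) L%:R *: (slope i k (step a i (L * t)) - S).
  rewrite column !opprB; move: (face i k a) (face i k b) (_ *: S).
  move=> A B C; rewrite [RHS]addrA; congr (_ - _).
  by rewrite -addrA subrKA addrC subrKA.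
have face_le x : `|face i k x - G x| <= L%:R * (lam * n.-1%:R).
  apply: le_trans (face_near _ _ _) _; rewrite [leRHS]mulrC -mulrA.
  by rewrite !ler_wpM2l// lerBlDr lerDl.
apply: le_trans (ler_normD _ _) _; rewrite mulrDr lerD//.
  apply: le_trans (ler_normB _ _) _.
  have := face_le a; have := face_le b; lra.
apply: le_trans (ler_norm_sum _ _ _) _; rewrite mulr_sumr.
by apply: ler_sum => t _; rewrite normrZ ger0_norm.
Qed.

End GridSlopes.

(** * A cube on which the slopes are nearly constant *)

Section FlatCubes.
Variables (R : realType) (n N : nat) (Y : normedModType R).
Variables (G : ('I_n -> nat) -> Y) (lam p : R).
Hypotheses (N_gt0 : (0 < N)%N) (lam_ge0 : 0 <= lam) (p_ge1 : 1 <= p).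
Hypothesis G_lip : forall x y : 'I_n -> nat,
  `|G x - G y| <= lam * \sum_i `|(x i)%:R - (y i)%:R|.

Let cells := cell n N.
Let subcube (b : 'I_n -> nat) (k : nat) (c : cells) :=
  translate b (N ^ k) (coords c).
Let energy (k : nat) (b : 'I_n -> nat) : R :=
  \sum_i `|slope N G i k b| `^ p.

(** If no cube were flat, the energy of every cube would be smaller, by more
    than [n lam ^ p / T], than the largest energy of its children; after [T]
    generations this contradicts the bound [n lam ^ p] on energies. *)
Lemma exists_flat_cube (a : 'I_n -> nat) (T : nat) : (0 < T)%N ->
  exists (k : nat) (b : 'I_n -> nat),
    [/\ (k < T)%N,
        forall i, (a i <= b i)%N /\ (b i + N ^ k.+1 <= a i + N ^ T)%N &
        \sum_c energy k (subcube b k c) <=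
          (N ^ n)%:R * (energy k.+1 b + n%:R * lam `^ p / T%:R)].
Proof.
move=> T_gt0; set gamma := _ / _; apply: contrapT => no_flat.
pose within k b := forall i, (a i <= b i)%N /\ (b i + N ^ k <= a i + N ^ T)%N.
have card_pos : 0 < (N ^ n)%:R :> R by rewrite ltr0n expn_gt0 N_gt0.
have increment k b B : (k < T)%N -> within k.+1 b ->
    (forall c, energy k (subcube b k c) <= B) -> energy k.+1 b + gamma < B.
  move=> kT bin childB; rewrite ltNge; apply/negP => Ble; apply: no_flat.
  exists k, b; split => //; apply: le_trans (ler_sum _ (fun c _ => childB c)) _.
  by rewrite sumr_const card_cell -[B *+ _]mulr_natl ler_wpM2l.
have within_child k b c : within k.+1 b -> within k (subcube b k c).
  move=> bin i; have [ab bT] := bin i; rewrite /subcube /translate /coords.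
  split; first exact: leq_trans ab (leq_addr _ _).
  apply: leq_trans bT; rewrite -addnA leq_add2l -mulnSr expnSr.
  by rewrite leq_mul2l ltn_ord orbT.
have energy_le k b : (k <= T)%N -> within k b ->
    energy k b + gamma *+ k <= n%:R * lam `^ p.
  elim: k b => [|k IH] b kT bin.
    rewrite mulr0n addr0 /energy mulr_natl.
    rewrite -[in X in _ *+ X](card_ord n) -sumr_const; apply: ler_sum => i _.
    apply: ge0_ler_powR; rewrite ?nnegrE//; first by apply: le_trans p_ge1.
    exact: norm_slope_le.
  have := increment k b (n%:R * lam `^ p - gamma *+ k) kT bin.
  rewrite mulrS addrA -lerBrDr => /(_ _)/ltW; apply=> c.
  by rewrite lerBrDr IH ?(ltnW kT)//; exact: within_child.
have top : within T.-1.+1 a by rewrite prednK// => i; split.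
have := increment T.-1 a (n%:R * lam `^ p - gamma *+ T.-1) _ top.
rewrite ltn_predL => /(_ T_gt0); rewrite ltNge => /(_ _)/negP; apply.
  move=> c; rewrite lerBrDr energy_le ?leq_pred//; exact: within_child.
rewrite lerBlDr -addrA -mulrS prednK//.
rewrite -[gamma *+ T]mulr_natr /gamma mulfVK ?pnatr_eq0 -?lt0n//.
by rewrite lerDr sumr_ge0// => i _; rewrite powR_ge0.
Qed.

Lemma sum_column_le (psi : ('I_n -> nat) -> R) i (c : cells) :
  (forall u, 0 <= psi u) ->
  \sum_(t < N) psi (update (coords c) i t) <= \sum_(c' : cells) psi (coords c').
Proof.
move=> psi_ge0.
pose h (t : 'I_N) : cells := [ffun j => if j == i then t else c j].
have h_inj : injective h.
  by move=> t u /ffunP/(_ i); rewrite !ffunE eqxx.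
rewrite [leRHS](bigID (mem [set h t | t in 'I_N]%SET))/=.
rewrite (big_imset _ (in2W h_inj))/=.
have -> : \sum_(t < N) psi (update (coords c) i t) =
          \sum_(t in 'I_N) psi (coords (h t)).
  apply: eq_bigr => t _; congr psi; apply/funext => j.
  by rewrite /coords /update ffunE; case: eqP.
by rewrite lerDl sumr_ge0.
Qed.

(** By convexity flatness bounds the p-th powers of the fluctuations summed
    over all children, hence over the children of any column; Jensen's
    inequality then bounds their sum along the column.  The factor
    [N ^ n.-1] in the hypothesis is the number of columns. *)
Lemma flat_cube_slopes (K eta : R) (T k : nat) (b : 'I_n -> nat) :
  0 < K -> 0 <= eta -> (0 < T)%N ->
  (forall x y : Y,
      2 * `|x| `^ p + 2 / K `^ p * `|y| `^ p
        <= `|x + y| `^ p + `|x - y| `^ p) ->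
  (2 * K) `^ p / 2 * n%:R * (N ^ n.-1)%:R <= T%:R * eta `^ p ->
  \sum_c energy k (subcube b k c) <=
    (N ^ n)%:R * (energy k.+1 b + n%:R * lam `^ p / T%:R) ->
  forall i (c : cells),
  \sum_(t < N) `|slope N G i k (translate b (N ^ k) (update (coords c) i t))
                 - slope N G i k.+1 b| <= N%:R * (eta * lam).
Proof.
move=> K0 eta0 T0 convY budget flat i c.
pose dev j u := `|slope N G j k (translate b (N ^ k) u) - slope N G j k.+1 b|.
have n_gt0 : (0 < n)%N by apply: leq_ltn_trans (ltn_ord i).
have total_dev : \sum_j \sum_(c : cells) dev j (coords c) `^ p <=
    N%:R * (eta * lam) `^ p.
  have convex j := uniformly_convex_mean (cell_gt0 n N_gt0)
    (fun c : cells => slope N G j k (subcube b k c)) p_ge1 K0 convY.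
  have := ler_sum (index_enum 'I_n) (fun j (_ : xpredT j) => convex j).
  rewrite big_split/= -!mulr_sumr card_cell.
  move: flat; rewrite /energy exchange_big/= => flat sum_convex.
  have := le_trans sum_convex flat; rewrite mulrDr lerD2l.
  set D := \sum_j \sum_c _; rewrite -/D => D_le.
  set C := (2 * K) `^ p in budget D_le.
  have C_pos : 0 < C by rewrite powR_gt0// mulr_gt0.
  have T_pos : 0 < T%:R :> R by rewrite ltr0n.
  clearbody C D.
  have DE : D = C / 2 * (2 / C * D).
    by field; exact: lt0r_neq0.
  rewrite {}DE.
  apply: le_trans (ler_wpM2l (divr_ge0 (ltW C_pos) (ler0n R 2)) D_le) _.
  have := ler_wpM2r (mulr_ge0 (ler0n R N) (powR_ge0 lam p)) budget.
  have -> : (N ^ n)%:R = N%:R * (N ^ n.-1)%:R :> R.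
    by rewrite -natrM -expnS prednK.
  have -> : T%:R * eta `^ p * (N%:R * lam `^ p) =
      T%:R * (N%:R * (eta * lam) `^ p) by rewrite powRM//; ring.
  have -> : C / 2 * n%:R * (N ^ n.-1)%:R * (N%:R * lam `^ p) = T%:R *
      (C / 2 * (N%:R * (N ^ n.-1)%:R * (n%:R * lam `^ p / T%:R))).
    by field; exact: lt0r_neq0.
  by rewrite (ler_pM2l T_pos).
have column_dev : \sum_(t < N) dev i (update (coords c) i t) `^ p <=
    N%:R * (eta * lam) `^ p.
  apply: le_trans total_dev; rewrite (bigD1 i)//=.
  apply: (le_trans (sum_column_le (psi := fun u => dev i u `^ p) _ _ _)).
    by move=> u; exact: powR_ge0.
  rewrite lerDl !sumr_ge0// => j _; rewrite sumr_ge0// => ? _.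
  exact: powR_ge0.
have := powR_mean_le p_ge1
  (fun t : 'I_N => normr_ge0 _ : 0 <= dev i (update (coords c) i t)).
rewrite card_ord => /le_trans/(_ column_dev).
rewrite ler_pM2l ?ltr0n// => mean_pow.
rewrite -ler_pdivrMl ?ltr0n// leNgt; apply/negP => lt_mean.
suff : (eta * lam) `^ p <
    (N%:R^-1 * \sum_(t < N) dev i (update (coords c) i t)) `^ p.
  by rewrite ltNge mean_pow.
apply: gt0_ltr_powR => //; rewrite ?nnegrE ?mulr_ge0 ?invr_ge0 ?sumr_ge0//.
  exact: lt_le_trans p_ge1.
by move=> t _; exact: normr_ge0.
Qed.

End FlatCubes.

(** * From flat cubes to affine approximation *)

(** The last interval is closed, so that the right end point [N * L] also has
    an index below [N]. *)
Lemma exists_subdivision_index (R : realType) (N : nat) (L x : R) :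
  (0 < N)%N -> 0 < L -> 0 <= x <= N%:R * L ->
  exists t : 'I_N, t%:R * L <= x <= t.+1%:R * L.
Proof.
move=> N_gt0 L0 /andP[x0 xN].
have [xlt|xge] := ltP x (N%:R * L).
  have /andP[tx xt] := truncn_itv (divr_ge0 x0 (ltW L0)).
  have tN : (Num.truncn (x / L) < N)%N.
    by rewrite -(ltr_nat R) (le_lt_trans tx)// ltr_pdivrMr.
  by exists (Ordinal tN); rewrite -ler_pdivlMr// tx -ler_pdivrMr// ltW.
have tN : (N.-1 < N)%N by rewrite prednK.
exists (Ordinal tN); rewrite /= prednK// xN andbT.
by apply: le_trans xge; rewrite ler_pM2r// ler_nat leq_pred.
Qed.

Section AlmostAffineCubes.
Variables (R : realType) (n N : nat) (Y : normedModType R) (lam eta : R).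
Hypotheses (lam_ge0 : 0 <= lam) (N_gt0 : (0 < N)%N).

(** The corner is joined to the given point by changing one coordinate at a
    time; each leg stays inside one column of children. *)
Lemma grid_near_affine (G : ('I_n -> nat) -> Y) (k : nat) (b : 'I_n -> nat)
    (S : 'I_n -> Y) :
  (forall x y : 'I_n -> nat,
    `|G x - G y| <= lam * \sum_i `|(x i)%:R - (y i)%:R|) ->
  (forall i (c : cell n N),
    \sum_(t < N)
      `|slope N G i k (translate b (N ^ k) (update (coords c) i t)) - S i|
      <= N%:R * (eta * lam)) ->
  forall c : cell n N,
  `|G (translate b (N ^ k) (coords c)) - G b
      - \sum_i (N ^ k * c i)%:R *: S i|
    <= n%:R * ((N ^ k)%:R * (2 * lam * n.-1%:R + N%:R * (eta * lam))).
Proof.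
move=> G_lip flat c; set L := (N ^ k)%N; set E := L%:R * _.
pose prefix m (j : 'I_n) := if (j < m)%N then (c j : nat) else 0%N.
have prefix_near m : (m <= n)%N ->
    `|G (translate b L (prefix m)) - G b
        - \sum_(i < n | (i < m)%N) (L * c i)%:R *: S i| <= m%:R * E.
  elim: m => [|m IH] mn.
    rewrite big_pred0// subr0 (_ : translate _ _ _ = b) ?subrr ?normr0 ?mul0r//.
    by apply/funext => j; rewrite /translate /prefix muln0 addn0.
  pose i := Ordinal mn.
  pose cm : cell n N :=
    [ffun j : 'I_n => if (j < m)%N then c j else Ordinal N_gt0].
  have prefix_step (t : nat) : step (translate b L (prefix m)) i (L * t) =
      translate b L (update (coords cm) i t).
    rewrite translate_update; congr (step _ i _); apply/funext => j.
    rewrite /translate /prefix /update /coords ffunE.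
    have [->|ji] := eqVneq j i; first by rewrite ltnn.
    by case: ifP.
  have -> : translate b L (prefix m.+1) =
      step (translate b L (prefix m)) i (L * c i).
    apply/funext => j; rewrite prefix_step /translate /prefix /update /coords.
    have [->|ji] := eqVneq j i; first by rewrite /= ltnSn.
    have jm : (j : nat) != m.
      by apply: contra ji => /eqP jm; apply/eqP/val_inj.
    rewrite ltnS leq_eqVlt (negPf jm) /=.
    by rewrite ffunE; case: ifP.
  have -> : \sum_(j < n | (j < m.+1)%N) (L * c j)%:R *: S j =
      (L * c i)%:R *: S i + \sum_(j < n | (j < m)%N) (L * c j)%:R *: S j.
    rewrite (bigD1 i) ?ltnSn//=; congr (_ + _); apply: eq_bigl => j.
    by rewrite ltnS -(inj_eq val_inj)/= andbC -ltn_neqAle.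
  set g0 := G (translate b L (prefix m)); set g1 := G _.
  set s := \sum_(j < n | _) _.
  have -> : g1 - G b - ((L * c i)%:R *: S i + s) =
      (g1 - g0 - (L * c i)%:R *: S i) + (g0 - G b - s).
    rewrite addrACA -opprD; congr (_ - _).
    by rewrite subrKA.
  apply: le_trans (ler_normD _ _) _.
  rewrite -natr1 mulrDl mul1r addrC lerD ?IH ?(ltnW mn)//.
  apply: le_trans
    (column_increment_near G_lip lam_ge0 N_gt0 i k _ (c i) (S i)) _.
  rewrite ler_wpM2l// lerD2l.
  apply: le_trans (flat i cm).
  under eq_bigr do rewrite -/L prefix_step.
  rewrite (big_ord_widen N (fun t =>
    `|slope N G i k (translate b L (update (coords cm) i t)) - S i|));
    last exact: ltnW.
  by rewrite [leRHS](bigID (fun t : 'I_N => (t < c i)%N))/= lerDl sumr_ge0.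
have := prefix_near n (leqnn n).
have -> : translate b L (prefix n) = translate b L (coords c).
  by apply/funext => j; rewrite /translate /prefix ltn_ord.
by under eq_bigl do rewrite ltn_ord.
Qed.

(** A point of the cube is rounded to the corner of the child that contains it;
    this moves each coordinate by at most [N ^ k], which changes [F] and the
    affine map by at most [n * lam * N ^ k] each. *)
Lemma exists_almost_affine_cube (F : ('I_n -> R) -> Y) (p K : R) (T : nat) :
  (forall u v, `|F u - F v| <= lam * \sum_i `|u i - v i|) ->
  1 <= p -> 0 < K -> 0 <= eta -> (0 < T)%N ->
  (forall x y : Y,
      2 * `|x| `^ p + 2 / K `^ p * `|y| `^ p
        <= `|x + y| `^ p + `|x - y| `^ p) ->
  (2 * K) `^ p / 2 * n%:R * (N ^ n.-1)%:R <= T%:R * eta `^ p ->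
  exists (k : nat) (b : 'I_n -> nat) (S : 'I_n -> Y),
    [/\ (k < T)%N,
        forall i, (b i + N ^ k.+1 <= N ^ T)%N &
        forall u, (forall i, (b i)%:R <= u i <= (b i + N ^ k.+1)%:R) ->
          `|F u - F (fun i => (b i)%:R) - \sum_i (u i - (b i)%:R) *: S i|
            <= n%:R * ((N ^ k)%:R * lam * (2 * n%:R + N%:R * eta))].
Proof.
move=> F_lip p1 K0 eta0 T0 convY budget.
pose G (x : 'I_n -> nat) := F (fun i => (x i)%:R).
have G_lip x y : `|G x - G y| <= lam * \sum_i `|(x i)%:R - (y i)%:R|.
  exact: F_lip.
have [k [b [kT bT flat]]] :=
  exists_flat_cube N_gt0 lam_ge0 p1 G_lip (fun=> 0%N) T0.
exists k, b, (fun i => slope N G i k.+1 b); split => //.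
  by move=> i; have [] := bT i.
move=> u ub; set L := (N ^ k)%N.
have L0 : 0 < L%:R :> R by rewrite ltr0n expn_gt0 N_gt0.
have /choice[c cP] i : exists t : 'I_N,
    t%:R * L%:R <= u i - (b i)%:R <= t.+1%:R * L%:R.
  apply: exists_subdivision_index => //.
  by have := ub i; rewrite natrD expnS natrM; lra.
pose c' : cell n N := [ffun i => c i].
pose v := translate b L (coords c').
have uv i : `|u i - (v i)%:R| <= L%:R.
  rewrite /v /translate /coords ffunE natrD natrM opprD addrA ler_norml.
  by have := cP i; rewrite -natr1; lra.
have := grid_near_affine G_lip
  (flat_cube_slopes N_gt0 lam_ge0 p1 K0 eta0 T0 convY budget flat) c'.
rewrite -/L -/v => near_v.
set S := fun i => slope N G i k.+1 b.
have -> : F u - F (fun i => (b i)%:R) - \sum_i (u i - (b i)%:R) *: S i =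
    (F u - G v) - (\sum_i (u i - (v i)%:R) *: S i)
      + (G v - G b - \sum_i (L * c' i)%:R *: S i).
  rewrite addrACA subrKA -opprD -big_split/=; congr (_ - _).
  apply: eq_bigr => i _; rewrite -scalerDl; congr (_ *: _).
  by rewrite /v /translate natrD; ring.
have sum_uv : \sum_i `|u i - (v i)%:R| <= n%:R * L%:R.
  rewrite mulr_natl -[in X in _ *+ X](card_ord n) -sumr_const.
  exact: ler_sum.
apply: le_trans (ler_normD _ _) _.
apply: (@le_trans _ _ ((lam * (n%:R * L%:R) + lam * (n%:R * L%:R)) +
   n%:R * (L%:R * (2 * lam * n.-1%:R + N%:R * (eta * lam))))).
  rewrite lerD//; apply: le_trans (ler_normB _ _) _; rewrite lerD//.
    by apply: le_trans (F_lip _ _) _; rewrite ler_wpM2l.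
  apply: le_trans (ler_norm_sum _ _ _) _.
  apply: (@le_trans _ _ (lam * \sum_i `|u i - (v i)%:R|)); last first.
    by rewrite ler_wpM2l.
  rewrite mulr_sumr; apply: ler_sum => i _; rewrite normrZ mulrC ler_wpM2r//.
  exact: norm_slope_le.
have [->|n_gt0] := posnP n; first by rewrite !mul0r mulr0 !addr0.
have -> : n%:R = n.-1%:R + 1 :> R by rewrite natr1 prednK.
rewrite le_eqVlt; apply/orP; left; apply/eqP; ring.
Qed.

End AlmostAffineCubes.

(** * A basis of almost maximal volume *)

Section NearAuerbach.
Variables (R : realType) (n : nat) (X : normedModType R).
Variable phi : {linear X -> 'rV[R]_n}.
Hypothesis phi_bij : bijective phi.

Lemma ler_coord_mx_norm (v : 'rV[R]_n) (i : 'I_n) : `|v 0 i| <= `|v|.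
Proof.
rewrite (_ : `|v| = mx_norm v)// mx_normrE.
exact: (le_bigmax _ (fun ij => `|v ij.1 ij.2|) (0, i)).
Qed.

(** The norm of X read in coordinates is continuous and positive on the unit
    sphere for the maximum norm, which is compact. *)
Lemma coordinates_bounded :
  exists2 B : R, 0 <= B & forall x i, `|phi x 0 i| <= B * `|x|.
Proof.
have [psi phiK psiK] := phi_bij.
pose len (v : 'rV[R]_n) : R := `|psi v|.
pose sphere := [set v : 'rV[R]_n | `|v| = 1].
have [sphere0|/nonemptyPn sphere0] := pselect (sphere !=set0); last first.
  exists 0 => // x i; rewrite mul0r.
  have -> : phi x = 0.
    apply/eqP/negPn/negP => phix.
    suff : sphere (`|phi x|^-1 *: phi x) by rewrite sphere0.
    by rewrite /sphere /= normrZ normfV normr_id mulVf// normr_eq0.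
  by rewrite mxE normr0.
have psiE v : psi v = \sum_i v 0 i *: psi (delta_mx 0 i).
  apply: (can_inj phiK); rewrite psiK linear_sum [LHS]row_sum_delta.
  by apply: eq_bigr => i _; rewrite linearZ/= psiK.
have len_cont : {within sphere, continuous len}.
  apply: continuous_subspaceT => v.
  apply: (continuous_comp _ (@norm_continuous _ _ _)).
  rewrite (_ : psi = fun v => \sum_i v 0 i *: psi (delta_mx 0 i)); last first.
    exact/funext.
  apply: continuous_big => [|i _ w]; first exact: add_continuous.
  apply: cvgZr_tmp; [exact: (@nbhs_filter _ w)|exact: coord_continuous].
have sphere_compact : compact sphere.
  apply: bounded_closed_compact.
    exists 1; split => [|M M1 v /= ->]; [exact: num_real|exact: ltW].
  rewrite (_ : sphere = Num.norm @^-1` [set 1]); last by [].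
  apply: closed_comp; last exact: closed_eq.
  by move=> v _; exact: norm_continuous.
have [c c_sphere c_min] := compact_EVT_min sphere0 sphere_compact len_cont.
have len_gt0 : 0 < len c.
  rewrite normr_gt0; apply/eqP => psic; move: c_sphere; rewrite inE /sphere /=.
  by rewrite -(psiK c) psic linear0 normr0 => /eqP; rewrite eq_sym oner_eq0.
exists (len c)^-1; first by rewrite invr_ge0 ltW.
move=> x i; apply: le_trans (ler_coord_mx_norm _ _) _.
have [->|phix] := eqVneq (phi x) 0.
  by rewrite normr0 mulr_ge0// invr_ge0 ltW.
have : len c <= len (`|phi x|^-1 *: phi x).
  apply: c_min; rewrite inE /sphere /= normrZ normfV normr_id mulVf//.
  by rewrite normr_eq0.
rewrite /len -linearZ phiK normrZ normfV normr_id.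
rewrite ler_pdivlMl ?normr_gt0// => le_x.
by rewrite ler_pdivlMl// mulrC.
Qed.

Definition frame_mx (E : 'I_n -> X) : 'M[R]_n := \matrix_(i, j) phi (E i) 0 j.

(** Cramer's rule: the product with the adjugate is a Laplace expansion along
    the replaced row. *)
Lemma det_frame_update (E : 'I_n -> X) (i : 'I_n) (x : X) :
  (phi x *m \adj (frame_mx E)) 0 i = \det (frame_mx (update E i x)).
Proof.
rewrite (expand_det_row _ i) mxE; apply: eq_bigr => j _.
rewrite !mxE /update eqxx; congr (_ * _).
rewrite /cofactor; congr (_ * \det _); apply/matrixP => k l.
by rewrite !mxE eq_sym (negPf (neq_lift _ _)).
Qed.

(** If the volume of [e] is more than a fraction [1 / C] of the supremum over
    the unit ball, replacing one vector of [e] by a unit vector multiplies the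
    volume by at most [C]; by Cramer's rule this factor is a coordinate. *)
Lemma exists_near_auerbach_basis (C : R) : 1 < C ->
  exists (a : {linear X -> 'rV[R]_n}) (e : 'I_n -> X),
    [/\ forall i, `|e i| <= 1,
        forall x, x = \sum_i a x 0 i *: e i,
        forall y : 'rV[R]_n, a (\sum_i y 0 i *: e i) = y &
        forall x i, `|a x 0 i| <= C * `|x|].
Proof.
move=> C1; have [psi phiK psiK] := phi_bij.
have [B B0 coordB] := coordinates_bounded.
pose vol (E : 'I_n -> X) := `|\det (frame_mx E)|.
pose vols := vol @` [set E | forall i, `|E i| <= 1].
have vols_ub : has_ubound vols.
  exists (\sum_(s : 'S_n) \prod_(i < n) B) => _ [E E1 <-].
  apply: le_trans (ler_norm_sum _ _ _) _; apply: ler_sum => s _.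
  rewrite normrM normrX normrN normr1 expr1n mul1r normr_prod.
  apply: ler_prod => i _; rewrite normr_ge0 mxE.
  by apply: le_trans (coordB _ _) _; rewrite ler_piMr.
have vols_sup : has_sup vols.
  by split => //; exists (vol (fun=> 0)), (fun=> 0) => // i; rewrite normr0.
have sup_gt0 : 0 < sup vols.
  pose m := 1 + \sum_i `|psi (delta_mx 0 i)|.
  have m0 : 0 < m by rewrite ltr_wpDr// sumr_ge0.
  apply: (@lt_le_trans _ _ (vol (fun i => m^-1 *: psi (delta_mx 0 i)))).
    rewrite /vol (_ : frame_mx _ = (m^-1)%:M).
      by rewrite det_scalar normr_gt0 expf_neq0// invr_neq0// gt_eqF.
    apply/matrixP => i j; rewrite !mxE linearZ/= psiK !mxE eqxx/=.
    by rewrite mulr_natr eq_sym.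
  apply: ub_le_sup => //; exists (fun i => m^-1 *: psi (delta_mx 0 i)) => // i.
  rewrite normrZ gtr0_norm ?invr_gt0// ler_pdivrMl// mulr1 /m (bigD1 i)//=.
  by rewrite addrCA lerDl addr_ge0// sumr_ge0.
have C0 : 0 < C by apply: lt_trans C1.
have gap : 0 < sup vols - sup vols / C.
  by rewrite subr_gt0 ltr_pdivrMr// ltr_pMr.
have [_ [E E1 <-]] := sup_adherent gap vols_sup.
rewrite opprB addrC subrK => vol_large.
have vol_gt0 : 0 < vol E by apply: lt_trans vol_large; rewrite divr_gt0.
have E_unit : frame_mx E \in unitmx by rewrite unitmxE unitfE -normr_gt0.
pose a : {linear X -> 'rV[R]_n} := mulmxr (invmx (frame_mx E)) \o phi.
have sumE (y : 'rV[R]_n) : phi (\sum_i y 0 i *: E i) = y *m frame_mx E.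
  apply/rowP => j; rewrite linear_sum summxE mxE.
  by apply: eq_bigr => i _; rewrite linearZ !mxE.
exists a, E; split => //.
- by move=> x; apply: (can_inj phiK); rewrite sumE /= mulmxKV.
- by move=> y; rewrite /a /= sumE mulmxK.
move=> x i.
have a_det z : `|a z 0 i| = vol (update E i z) / vol E.
  rewrite /a /= /invmx E_unit -scalemxAr mxE det_frame_update normrM normfV.
  by rewrite mulrC.
have a_unit z : `|z| <= 1 -> `|a z 0 i| <= C.
  move=> z1; rewrite a_det ler_pdivrMr//.
  apply: (@le_trans _ _ (sup vols)).
    apply: ub_le_sup => //; exists (update E i z) => // j.
    by rewrite /update; case: ifP.
  by rewrite mulrC -ler_pdivrMr// ltW.
have [->|x0] := eqVneq x 0.
  by rewrite linear0 mxE !normr0 mulr0.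
have := a_unit (`|x|^-1 *: x).
rewrite linearZ mxE normrZ normrM normfV normr_id mulVf ?normr_eq0//.
by move=> /(_ (lexx _)); rewrite ler_pdivrMl ?normr_gt0// mulrC.
Qed.

End NearAuerbach.

(** * Transfer to the unit ball of X *)

Section LipschitzConstant.
Variables (R : realType) (X Y : normedModType R) (f : X -> Y).

Lemma lip_const_fin (A : set X) : A !=set0 -> [lipschitz f x | x in A] ->
  exists L : R, [/\ 0 <= L, lip_const A f = L%:E &
    forall x y, A x -> A y -> `|f x - f y| <= L * `|x - y|].
Proof.
move=> [a Aa] /pinfty_ex_gt0[M M0 f_lip].
have lip_ge0 : (0 <= lip_const A f)%E.
  apply: ereal_sup_ubound; exists (a, a) => //=.
  by rewrite !subrr !normr0 mul0r.
have lip_le : (lip_const A f <= M%:E)%E.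
  apply: ub_ereal_sup => _ [[x y] [Ax Ay] <-] /=; rewrite lee_fin.
  have [->|xy] := eqVneq x y; first by rewrite !subrr !normr0 mul0r ltW.
  by rewrite ler_pdivrMr ?normr_gt0 ?subr_eq0//; exact: (f_lip (x, y)).
have lipE : lip_const A f = (fine (lip_const A f))%:E.
  by rewrite fineK// ge0_fin_numE// (le_lt_trans lip_le)// ltry.
exists (fine (lip_const A f)); split => //; first exact: fine_ge0.
move=> x y Ax Ay; have [->|xy] := eqVneq x y.
  by rewrite !subrr !normr0 mulr0.
rewrite -ler_pdivrMr ?normr_gt0 ?subr_eq0// -lee_fin -lipE.
by apply: ereal_sup_ubound; exists (x, y).
Qed.

End LipschitzConstant.

Section Clamp.
Variable R : realType.

(** Precomposing with a retraction of the real line onto the interval from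
    -1 to 1 extends a map on a cube to all coordinate vectors without
    increasing its Lipschitz constant. *)
Definition clamp (t : R) : R := Num.max (- 1) (Num.min 1 t).

Lemma norm_clamp_le1 t : `|clamp t| <= 1.
Proof.
rewrite /clamp ler_norml; apply/andP; split; first by rewrite le_max lexx.
rewrite ge_max ge_min lexx/= andbT; lra.
Qed.

Lemma clamp_id t : `|t| <= 1 -> clamp t = t.
Proof. by rewrite ler_norml /clamp => /andP[tl tr]; rewrite min_r// max_r. Qed.

Lemma clamp_lip s t : `|clamp s - clamp t| <= `|s - t|.
Proof.
have clampE r : clamp r =
    if 1 <= r then 1 else if r <= - 1 then - 1 else r.
  rewrite /clamp; case: (leP 1 r) => r1; first by rewrite max_r//; lra.
  by case: (leP r (- 1)).
have := ler_norm (s - t); have := ler_norm (t - s); rewrite (distrC t s).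
rewrite ler_norml !clampE.
case: (leP 1 s) => ?; case: (leP 1 t) => ?; try lra.
- by case: (leP t (- 1)) => ?; lra.
- by case: (leP s (- 1)) => ?; lra.
by case: (leP s (- 1)) => ?; case: (leP t (- 1)) => ?; lra.
Qed.

End Clamp.

Section Transfer.
Variables (R : realType) (n : nat) (X Y : normedModType R).
Hypotheses (n_gt0 : (0 < n)%N) (dimX : Vector.axiom n X).

(** The sums of the vectors [e i / n] with coefficients between -1 and 1 lie in
    the ball and form a cube in coordinates.  Rescaled to side [N ^ T], it
    carries a map with Lipschitz constant [2 L / (n N ^ T)] per coordinate.  A
    subcube of side [N ^ k.+1] contains the ball of radius
    [N ^ k.+1 / (N ^ T n C)] around its center, since the coordinate
    functionals have norm at most [C]. *)
Lemma affinely_approximable_of_budget (p K C eps eta r : R) (N T : nat) :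
  1 <= p -> 0 < K -> 1 < C -> 0 < eps -> 0 <= eta -> (0 < N)%N -> (0 < T)%N ->
  (forall x y : Y,
      2 * `|x| `^ p + 2 / K `^ p * `|y| `^ p
        <= `|x + y| `^ p + `|x - y| `^ p) ->
  (2 * K) `^ p / 2 * n%:R * (N ^ n.-1)%:R <= T%:R * eta `^ p ->
  2 * C * n%:R * (2 * n%:R / N%:R + eta) <= eps ->
  r * (C * n%:R * (N ^ T.-1)%:R) <= 1 ->
  affinely_approximable_at X Y eps r.
Proof.
move=> p1 K0 C1 eps0 eta0 N_gt0 T_gt0 convY budget error_le radius_le f f_lip.
have [v2r v2r_lin v2r_bij] := dimX.
pose phi : {linear X -> 'rV[R]_n} :=
  HB.pack v2r (GRing.isLinear.Build R X 'rV[R]_n *:%R v2r v2r_lin).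
have [a [e [e_le1 xE aK a_le]]] :=
  exists_near_auerbach_basis (phi := phi) v2r_bij C1.
have ball0 : unit_cball (X:=X) 0.
  by rewrite /unit_cball /closed_ball_ /= subrr normr0.
have [L [L0 lipE Lf]] := lip_const_fin (ex_intro _ 0 ball0) f_lip.
pose Z : R := (N ^ T)%:R.
have Z0 : 0 < Z by rewrite ltr0n expn_gt0 N_gt0.
have n0 : 0 < n%:R :> R by rewrite ltr0n.
have N0 : 0 < N%:R :> R by rewrite ltr0n.
have C0 : 0 < C by apply: lt_trans C1.
pose P (u : 'I_n -> R) : X :=
  \sum_i (clamp (2 * u i / Z - 1) / n%:R) *: e i.
have P_ball u : unit_cball (P u).
  rewrite /unit_cball /closed_ball_ /= sub0r normrN.
  apply: le_trans (ler_norm_sum _ _ _) _.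
  apply: (@le_trans _ _ (\sum_(i < n) n%:R^-1)); last first.
    by rewrite sumr_const card_ord -[X in X <= _]mulr_natr mulVf// gt_eqF.
  apply: ler_sum => i _; rewrite normrZ normrM normfV (ger0_norm (ltW n0)).
  by rewrite -[leRHS]mulr1 ler_pM// ler_piMl ?invr_ge0// norm_clamp_le1.
pose lam := L * (2 / (n%:R * Z)).
have lam0 : 0 <= lam by rewrite mulr_ge0// divr_ge0// mulr_ge0// ltW.
have FP_lip (u v : 'I_n -> R) :
    `|f (P u) - f (P v)| <= lam * \sum_i `|u i - v i|.
  apply: le_trans (Lf _ _ (P_ball u) (P_ball v)) _.
  rewrite -mulrA ler_wpM2l// -sumrB mulr_sumr.
  apply: le_trans (ler_norm_sum _ _ _) _; apply: ler_sum => i _.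
  rewrite -scalerBl normrZ -mulrBl normrM normfV (ger0_norm (ltW n0)).
  apply: (@le_trans _ _ (`|2 * u i / Z - 1 - (2 * v i / Z - 1)| / n%:R)).
    rewrite -[leRHS]mulr1 ler_pM ?divr_ge0//.
    by rewrite ler_pM2r ?invr_gt0// clamp_lip.
  have -> : 2 * u i / Z - 1 - (2 * v i / Z - 1) = 2 / Z * (u i - v i) by ring.
  rewrite normrM ger0_norm ?divr_ge0// invfM.
  by rewrite le_eqVlt; apply/orP; left; apply/eqP; ring.
have [k [b [S [kT bT near_affine]]]] := exists_almost_affine_cube lam0 N_gt0
  FP_lip p1 K0 eta0 T_gt0 convY budget.
pose h : R := (N ^ k.+1)%:R.
have h0 : 0 < h by rewrite ltr0n expn_gt0 N_gt0.
pose y : 'rV[R]_n := \row_i (((2 * (b i)%:R + h) / Z - 1) / n%:R).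
pose rho := h / (Z * n%:R * C).
pose U x i := Z * (n%:R * a x 0 i + 1) / 2.
pose center := \sum_i y 0 i *: e i.
have U_cube z : closed_ball_ Num.norm center rho z ->
    forall i, (b i)%:R <= U z i <= (b i + N ^ k.+1)%:R.
  move=> zball i.
  have : `|y 0 i - a z 0 i| <= h / (Z * n%:R).
    have := le_trans (a_le (center - z) i) (ler_wpM2l (ltW C0) zball).
    rewrite linearB aK !mxE => /le_trans; apply.
    rewrite /rho le_eqVlt; apply/orP; left; apply/eqP; field.
    by rewrite !gt_eqF.
  rewrite mxE ler_norml => /andP[lo hi].
  have Zn0 : 0 <= Z * n%:R / 2 by rewrite divr_ge0// mulr_ge0// ltW.
  have := ler_wpM2l Zn0 lo; have := ler_wpM2l Zn0 hi; rewrite !mulrBr.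
  have -> : Z * n%:R / 2 * (((2 * (b i)%:R + h) / Z - 1) / n%:R) =
      (b i)%:R + h / 2 - Z / 2.
    by field; rewrite !gt_eqF.
  rewrite mulrN.
  have -> : Z * n%:R / 2 * (h / (Z * n%:R)) = h / 2.
    by field; rewrite !gt_eqF.
  have -> : Z * n%:R / 2 * a z 0 i = U z i - Z / 2 by rewrite /U; ring.
  rewrite natrD -/h; lra.
have PU z : closed_ball_ Num.norm center rho z -> P (U z) = z.
  move=> /U_cube zc; rewrite [RHS]xE; apply: eq_bigr => i _; congr (_ *: _).
  rewrite clamp_id; first by rewrite /U; field; rewrite !gt_eqF.
  have /andP[lo hi] := zc i.
  have Uhi : U z i <= Z by apply: le_trans hi _; rewrite ler_nat bT.
  have Ulo : 0 <= U z i by apply: le_trans lo; rewrite ler0n.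
  have Uhi' : U z i / Z <= 1 by rewrite ler_pdivrMr// mul1r.
  have Ulo' : 0 <= U z i / Z by rewrite divr_ge0// ltW.
  by rewrite ler_norml -mulrA; lra.
exists center, rho, (fun x => f (P (fun i => (b i)%:R))
  + \sum_i (U x i - (b i)%:R) *: S i); split.
- rewrite /rho ler_pdivlMr ?mulr_gt0//.
  apply: (@le_trans _ _ N%:R); last first.
    by rewrite ler_nat expnS leq_pmulr// expn_gt0 N_gt0.
  have := ler_wpM2r (ltW N0) radius_le; rewrite mul1r; apply: le_trans.
  have -> : Z = (N ^ T.-1)%:R * N%:R by rewrite -natrM -expnSr prednK.
  by rewrite le_eqVlt; apply/orP; left; apply/eqP; ring.
- by move=> z /PU <-; exact: P_ball.
- pose T0 x := \sum_i (Z * n%:R / 2 * a x 0 i) *: S i.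
  have T0_lin : linear T0.
    move=> t x z; rewrite /T0 scaler_sumr -big_split/=; apply: eq_bigr => i _.
    rewrite scalerA -scalerDl linearP !mxE; congr (_ *: _); ring.
  pose T1 : {linear X -> Y} :=
    HB.pack T0 (GRing.isLinear.Build R X Y *:%R T0 T0_lin).
  exists T1.
  exists (f (P (fun i => (b i)%:R)) + \sum_i (Z / 2 - (b i)%:R) *: S i) => x.
  rewrite /= addrCA; congr (_ + _); rewrite /T0 -big_split/=.
  apply: eq_bigr => i _; rewrite -scalerDl; congr (_ *: _).
  by rewrite /U; ring.
- rewrite lipE -EFinM; apply: ub_ereal_sup => _ [z zball <-].
  have rho0 : 0 < rho by rewrite divr_gt0// mulr_gt0// mulr_gt0.
  rewrite lee_fin ler_pdivrMr//.
  have := near_affine _ (U_cube z zball); rewrite PU// opprD addrA.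
  move/le_trans; apply.
  have := ler_wpM2r (mulr_ge0 L0 (ltW rho0)) error_le; rewrite [leRHS]mulrA.
  apply: le_trans; rewrite le_eqVlt; apply/orP; left; apply/eqP.
  rewrite /lam /rho /h expnSr natrM; field.
  by rewrite !gt_eqF.
Qed.

End Transfer.

(** * Choice of the parameters *)

Lemma le_affine_modulus (R : realType) (X Y : normedModType R) (eps r : R) :
  0 < r <= 1 -> affinely_approximable_at X Y eps r ->
  r <= affine_modulus X Y eps.
Proof.
move=> r01 r_approx; apply: ub_le_sup => //.
by exists 1 => s [/andP[_ s1] _].
Qed.

Lemma exists_nat_succ_ge (R : realType) (t : R) : 0 <= t ->
  exists m : nat, [/\ (0 < m)%N, t <= m%:R & m.-1%:R <= t].
Proof.
move=> t0; exists (Num.truncn t).+1; split => //.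
  by rewrite ltW// truncnS_gt.
by rewrite /= truncn_le.
Qed.

(** The two terms of the error budget are balanced: [N >= 9 n ^ 2 / eps] and
    the fluctuation [eta = 2 eps / (9 n)] contribute half of [eps] each, when
    the coordinate functionals have norm at most 9/8.  This value is close
    enough to 1 for the constant 16 of the one-dimensional bound, and turns
    the number of generations into a multiple of [(9 n K / eps) ^ p]. *)
Lemma affine_modulus_ge (R : realType) (n N : nat) (X Y : normedModType R)
    (p K eps E : R) :
  (0 < n)%N -> (0 < N)%N -> 9 * n%:R ^+ 2 / eps <= N%:R ->
  Vector.axiom n X -> 1 <= p -> 0 < K -> 0 < eps ->
  (forall x y : Y,
      2 * `|x| `^ p + 2 / K `^ p * `|y| `^ p
        <= `|x + y| `^ p + `|x - y| `^ p) ->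
  9 / 8 * n%:R * N%:R `^ (n%:R * N%:R ^+ n.-1 * (9 * n%:R * K / eps) `^ p / 2)
    <= eps^-1 `^ E ->
  eps `^ E <= affine_modulus X Y eps.
Proof.
move=> n_gt0 N_gt0 N_ge dimX p1 K0 eps0 convY; set tau := _ / 2 => scales_le.
have n0 : 0 < n%:R :> R by rewrite ltr0n.
have n1 : 1 <= n%:R :> R by rewrite ler1n.
have N0 : 0 < N%:R :> R by rewrite ltr0n.
have N1 : 1 <= N%:R :> R by rewrite ler1n.
have n98 : 1 <= 9 / 8 * n%:R :> R by lra.
have C1 : 1 < 9 / 8 :> R by lra.
have tau0 : 0 <= tau by rewrite divr_ge0// !mulr_ge0// ?exprn_ge0 ?powR_ge0.
have [T [T_gt0 tauT Ttau]] := exists_nat_succ_ge tau0.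
have radius_le : 9 / 8 * n%:R * (N ^ T.-1)%:R <= eps^-1 `^ E.
  apply: le_trans scales_le; rewrite ler_wpM2l ?mulr_ge0//.
  by rewrite natrX -powR_mulrn// ler_powR.
have powE : eps^-1 `^ E = (eps `^ E)^-1.
  by rewrite -[in LHS]powR_inv1 ?ltW// -powRrM mulN1r powRN.
have epsE0 : 0 < eps `^ E by rewrite powR_gt0.
apply: le_affine_modulus.
  rewrite epsE0 /= -[eps `^ E]invrK -powE invf_le1 ?powR_gt0 ?invr_gt0//.
  apply: le_trans radius_le.
  have : 1 <= (N ^ T.-1)%:R :> R by rewrite ler1n expn_gt0 N_gt0.
  by move=> NT1; rewrite (le_trans n98)// ler_peMr// (le_trans _ n98).
apply: (@affinely_approximable_of_budget R n X Y n_gt0 dimX p K (9 / 8) eps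
  (2 * eps / (9 * n%:R)) (eps `^ E) N T) => //.
- by rewrite divr_ge0// ?mulr_ge0 ?ltW.
- apply: le_trans (ler_wpM2r (powR_ge0 _ _) tauT).
  have -> : 2 * K = 9 * n%:R * K / eps * (2 * eps / (9 * n%:R)).
    by field; rewrite !gt_eqF.
  rewrite powRM; last 2 first.
  - by rewrite divr_ge0 ?mulr_ge0// ltW.
  - by rewrite divr_ge0 ?mulr_ge0// ltW.
  by rewrite natrX /tau le_eqVlt; apply/orP; left; apply/eqP; ring.
- have : 2 * n%:R / N%:R <= 2 * eps / (9 * n%:R).
    rewrite ler_pdivrMr// mulrAC ler_pdivlMr ?mulr_gt0//.
    move: N_ge; rewrite ler_pdivrMr//; lra.
  move=> N_small; apply: (@le_trans _ _ (2 * (9 / 8) * n%:R *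
      (2 * eps / (9 * n%:R) + 2 * eps / (9 * n%:R)))).
    by rewrite ler_wpM2l ?mulr_ge0// lerD2r.
  by rewrite le_eqVlt; apply/orP; left; apply/eqP; field; rewrite gt_eqF.
- by rewrite mulrC -ler_pdivlMr// mul1r -powE.
Qed.

(** For [x = 1 / eps] this compares the inverse of the radius, a product of
    powers of different bases, with a single power of [x]. *)
Lemma powR_scales_le (R : realType) (x A N a b tau E : R) :
  1 <= x -> 0 <= N -> 0 <= tau -> A <= x `^ a -> N <= x `^ b ->
  a + b * tau <= E -> A * N `^ tau <= x `^ E.
Proof.
move=> x1 N0 tau0 Aa Nb abE; apply: le_trans (ler_powR x1 abE).
rewrite powRD; last by rewrite (gt_eqF (lt_le_trans ltr01 x1)) implybT.
have Nt : N `^ tau <= x `^ (b * tau).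
  by rewrite powRrM ge0_ler_powR// nnegrE powR_ge0.
apply: (le_trans (ler_wpM2r (powR_ge0 _ _) Aa)).
by rewrite ler_wpM2l ?powR_ge0.
Qed.

Lemma expr4_ge16 (R : realType) (x : R) : 2 <= x -> 16 <= x ^+ 4.
Proof.
move=> x2; rewrite (_ : 16 = 2 ^+ 4); last by rewrite -natrX.
by rewrite lerXn2r// nnegrE; lra.
Qed.

(** Here [N <= x ^ 5], and [1 + (5 / 2) q <= 3 q <= (16 K x) ^ p] for
    [q = (9 K x) ^ p] because [(16 / 9) ^ 2 > 3]. *)
Lemma scales_le_dim1 (R : realType) (N : nat) (p K eps : R) :
  N.-1%:R <= 9 * 1%:R ^+ 2 / eps ->
  2 <= p -> 1 <= K -> 0 < eps -> eps < 1 / 2 ->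
  9 / 8 * 1%:R * N%:R `^ (1%:R * N%:R ^+ 0 * (9 * 1%:R * K / eps) `^ p / 2)
    <= eps^-1 `^ ((16 * K / eps) `^ p).
Proof.
move=> N_pred p2 K1 eps0 eps_lt; set x := eps^-1.
have x2 : 2 <= x by rewrite /x -[2]invrK lef_pV2 ?posrE//; lra.
have N_le : N%:R <= 10 * x.
  have : N%:R <= N.-1%:R + 1 :> R by rewrite natr1 ler_nat leqSpred.
  by move: N_pred; rewrite expr1n mulr1 -/x; lra.
rewrite !mulr1 !mul1r -/x; set q := (9 * K * x) `^ p.
have q18 : 2 <= q.
  apply: (@le_trans _ _ (9 * K * x)); first nra.
  by apply: le1r_powR; nra.
have qE : 3 * q <= (16 * K * x) `^ p.
  have -> : 16 * K * x = 16 / 9 * (9 * K * x) by field.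
  rewrite powRM; [|lra|nra].
  rewrite ler_wpM2r ?powR_ge0//.
  apply: (@le_trans _ _ ((16 / 9) `^ 2%:R)); last by apply: ler_powR; lra.
  by rewrite powR_mulrn; lra.
apply: (@powR_scales_le _ x _ _ 1 5%:R) => //; try lra.
- by rewrite powRr1; lra.
- apply: le_trans N_le _; rewrite powR_mulrn; last lra.
  rewrite exprSr ler_wpM2r//; first lra.
  by have := expr4_ge16 x2; lra.
Qed.

(** As the base of the power, [N] is bounded by [x ^ (2 n + 5)], using
    [n <= x ^ n].  In the exponent this would cost too much: there [N] is
    bounded by [n ^ 6 * x], numerical constants being absorbed by powers of
    [n >= 2]. *)
Lemma scales_le_dim_gt1 (R : realType) (n N : nat) (p K eps : R) :
  (1 < n)%N -> N.-1%:R <= 9 * n%:R ^+ 2 / eps ->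
  2 <= p -> 1 <= K -> 0 < eps -> eps < 1 / 2 ->
  9 / 8 * n%:R * N%:R `^ (n%:R * N%:R ^+ n.-1 * (9 * n%:R * K / eps) `^ p / 2)
    <= eps^-1 `^ (K `^ p * n%:R `^ (20 * (n%:R + p))
                  / eps `^ (2 * p + 2 * n%:R - 2)).
Proof.
move=> n_gt1 N_pred p2 K1 eps0 eps_lt.
set m : R := n%:R in N_pred *; set x := eps^-1 in N_pred *.
have x2 : 2 <= x by rewrite /x -[2]invrK lef_pV2 ?posrE//; lra.
have x0 : 0 < x by lra.
have m2 : 2 <= m by rewrite ler_nat.
have n_pred : n.-1%:R = m - 1 by rewrite /m -subn1 natrB// ltnW.
have nx : m <= x ^+ n.
  apply: (@le_trans _ _ (2 ^+ n)).
    by rewrite /m -natrX ler_nat ltnW// ltn_expl.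
  by rewrite lerXn2r ?nnegrE; lra.
have nE : (n + n + 5)%:R = 2 * m + 5 by rewrite !natrD /m; ring.
have nSE : n.+1%:R = m + 1 by rewrite -natr1.
clearbody m.
have exp_m : 1 <= 1 + 6 * (m - 1) + 5 * p by lra.
have exp_m' : 4%:R + (1 + 6 * (m - 1) + 5 * p) <= 20 * (m + p) by lra.
have mm : 4 <= m * m by rewrite (_ : 4 = 2 * 2); [rewrite ler_pM//|]; lra.
have m_mm : 2 * m <= m * m by rewrite ler_wpM2r//; lra.
have m4 : 4 * (m * m) <= m ^+ 4.
  by rewrite (_ : m ^+ 4 = (m * m) * (m * m)); [rewrite ler_wpM2r//; lra|ring].
have xE c : eps `^ c = (x `^ c)^-1.
  by rewrite -[eps]invrK -powR_inv1 ?invr_ge0 ?ltW// -powRrM mulN1r powRN.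
have N_le : N%:R <= 16 * m ^+ 2 * x.
  have : N%:R <= N.-1%:R + 1 :> R by rewrite natr1 ler_nat leqSpred.
  have : 1 <= m ^+ 2 * x by rewrite -[1]mulr1 ler_pM// ?expr2; lra.
  lra.
have N_le6 : N%:R <= m ^+ 6 * x.
  apply: le_trans N_le _; rewrite ler_wpM2r ?(ltW x0)//.
  rewrite (_ : m ^+ 6 = m ^+ 4 * m ^+ 2); last ring.
  by rewrite ler_wpM2r ?expr2; lra.
set tau := _ / 2.
have tau0 : 0 <= tau.
  by rewrite /tau divr_ge0// !mulr_ge0 ?exprn_ge0 ?powR_ge0//; lra.
(* Twice a bound for tau, obtained from 9 <= n ^ 4 and N <= n ^ 6 * x. *)
pose Q := m `^ (1 + 6 * (m - 1) + 5 * p) * K `^ p * x `^ (m - 1 + p).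
have mpos : m != 0 by apply/eqP; lra.
have xpos : x != 0 by rewrite gt_eqF.
have tau_le : tau <= Q / 2.
  rewrite /tau ler_wpM2r//.
  have N_pow : N%:R ^+ n.-1 <= m `^ (6 * (m - 1)) * x `^ (m - 1).
    apply: (@le_trans _ _ ((m ^+ 6 * x) ^+ n.-1)).
      by rewrite lerXn2r ?nnegrE// mulr_ge0 ?exprn_ge0//; lra.
    rewrite exprMn -exprM -!powR_mulrn ?natrM ?n_pred//; lra.
  have K_pow : (9 * m * K / eps) `^ p <= m `^ (5 * p) * K `^ p * x `^ p.
    rewrite powRrM -!powRM ?powR_ge0 ?mulr_ge0 ?powR_ge0//; try lra.
    rewrite ge0_ler_powR ?nnegrE ?mulr_ge0 ?powR_ge0 ?invr_ge0//; try lra.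
    rewrite (powR_mulrn 5) ?ler_wpM2r ?invr_ge0//; try lra.
    by rewrite exprSr ler_wpM2r; lra.
  apply: (@le_trans _ _ (m * (m `^ (6 * (m - 1)) * x `^ (m - 1)) *
    (m `^ (5 * p) * K `^ p * x `^ p))).
    by rewrite ler_pM ?mulr_ge0 ?exprn_ge0 ?powR_ge0 ?ler_wpM2l//; lra.
  rewrite /Q !powRD ?mpos ?xpos ?implybT// powRr1; last lra.
  by rewrite le_eqVlt; apply/orP; left; apply/eqP; ring.
have Q2 : 2 <= Q.
  rewrite /Q -[2]mulr1 ler_pM//.
    rewrite -[2]mulr1 ler_pM//.
      by apply: (le_trans m2); apply: le1r_powR => //; lra.
    by rewrite -[leLHS](powRr0 K); apply: ler_powR; lra.
  by rewrite -[leLHS](powRr0 x); apply: ler_powR; lra.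
apply: (@powR_scales_le _ x _ _ (n.+1)%:R (n + n + 5)%:R) => //; try lra.
- rewrite powR_mulrn ?(ltW x0)// exprS.
  by apply: ler_pM => //; lra.
- rewrite powR_mulrn ?(ltW x0)//; apply: le_trans N_le _.
  have -> : x ^+ (n + n + 5) = x ^+ 4 * (x ^+ n * x ^+ n) * x.
    by rewrite !exprD; ring.
  rewrite ler_wpM2r ?(ltW x0)// expr2.
  apply: ler_pM; [lra|nra|exact: expr4_ge16|].
  by apply: ler_pM; lra.
rewrite xE invrK; apply: (@le_trans _ _ (m ^+ 4 * Q)).
  rewrite nE nSE.
  have h : (2 * m + 5) * tau <= m ^+ 4 * (Q / 2).
    by rewrite ler_pM//; lra.
  have : m + 1 <= m ^+ 4 by lra.
  have : m ^+ 4 * 2 <= m ^+ 4 * Q by rewrite ler_wpM2l// exprn_ge0//; lra.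
  lra.
rewrite /Q -[m ^+ 4]powR_mulrn ?mulrA; last lra.
rewrite -powRD ?mpos ?implybT// [K `^ p * _]mulrC.
by rewrite !ler_pM ?mulr_ge0 ?powR_ge0// ler_powR//; lra.
Qed.

Unset Implicit Arguments.

Theorem theorem1p1 (R : realType) (n : nat) (p K : R)
    (X : normedModType R) (Y : completeNormedModType R)
    (n_gt0 : (0 < n)%N) (p_ge2 : 2 <= p) (K_ge1 : 1 <= K)
    (dimX : Vector.axiom n X)
    (convY : forall x y : Y,
      2 * `|x| `^ p + 2 / K `^ p * `|y| `^ p <= `|x + y| `^ p + `|x - y| `^ p)
    (eps : R) (eps_gt0 : 0 < eps) (eps_lt_half : eps < 1 / 2) :
  (if n == 1%N then eps `^ ((16 * K / eps) `^ p)
   else eps `^ (K `^ p * n%:R `^ (20 * (n%:R + p))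
                / eps `^ (2 * p + 2 * n%:R - 2)))
  <= affine_modulus X Y eps.
Proof.
have p1 : 1 <= p by lra.
have K0 : 0 < K by lra.
have scale_ge0 : 0 <= 9 * n%:R ^+ 2 / eps :> R.
  by rewrite divr_ge0 ?mulr_ge0 ?exprn_ge0 ?(ltW eps_gt0).
have [N [N_gt0 N_ge N_pred]] := exists_nat_succ_ge scale_ge0.
case: eqP => [n1|/eqP n_neq1].
  apply: (affine_modulus_ge n_gt0 N_gt0 N_ge dimX p1 K0 eps_gt0 convY).
  rewrite n1 in N_pred *.
  exact: (scales_le_dim1 N_pred p_ge2 K_ge1 eps_gt0 eps_lt_half).
apply: (affine_modulus_ge n_gt0 N_gt0 N_ge dimX p1 K0 eps_gt0 convY).
by apply: scales_le_dim_gt1 => //; rewrite ltn_neqAle eq_sym n_neq1.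
Qed.
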